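(* Let $p$ be a prime, let $q>p$ be a prime and let $d$ be a $p$-th power free integer. Let $N\equiv1\pmod p$ be a positive integer such that $\Phi_p(N)=kq$ for some positive integer $k<\sqrt{N}$. Assume $\gcd(N,pd)=1$ and $d^{\frac{N-1}{p}}\not\equiv1\pmod N$. Let $K=\mathbb{Q}(\sqrt[p]{d})$ with ring of integers $\mathcal{O}_K$ and $\mathcal{R}_N=\mathcal{O}_K/N\mathcal{O}_K$. Suppose there exists $w\in\mathcal{G}_N(d)$ such that $w^k\not\equiv1\pmod N$ (that is, $w^k\ne1$ in $\mathcal{R}_N$). Then $N$ is prime if and only if $\Phi_q(w^k)\equiv0\pmod N$ (that is, $\Phi_q(w^k)=0$ in $\mathcal{R}_N$).
   Context: For a prime $\ell$, $\Phi_\ell(x)=x^{\ell-1}+x^{\ell-2}+\cdots+x+1$ is the $\ell$-th cyclotomic polynomial. Congruences modulo $N$ between elements of $\mathcal{R}_N$ mean equality in $\mathcal{R}_N$. The generalized unitary group of degree $p$ is $\mathcal{G}_N(d):=\{w\in\mathcal{R}_N^\times\mid w^{\Phi_p(N)}=1\text{ in }\mathcal{R}_N\}$. *)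

(* Defs.v *)
From HB Require Import structures.
From mathcomp Require Import all_boot all_order all_algebra all_field.
From mathcomp Require Import boolp.

Set Implicit Arguments.
Unset Strict Implicit.
Unset Printing Implicit Defensive.

Import Order.TTheory GRing.Theory Num.Theory.
Local Open Scope ring_scope.
Local Open Scope quotient_scope.

(* The value of x^(l-1) + ... + x + 1, usable at naturals and in rings that   *)
(* are not known to be nontrivial (so have no polynomial ring in MathComp).   *)
Definition Phi (l : nat) (R : pzSemiRingType) (x : R) : R :=
  \sum_(i < l) x ^+ i.
Arguments Phi l {R} x.

Lemma Cyclotomic_prime (l : nat) : prime l -> 'Phi_l = \sum_(i < l) 'X^i.
Proof.
move=> pr_l; have l_gt0 := prime_gt0 pr_l.
have P1 : 'Phi_1 = 'X - 1 :> {poly int}.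
  by have := prod_Cyclotomic (isT : (0 < 1)%N); rewrite big_seq1 expr1.
have nz : 'X - 1 != 0 :> {poly int} by rewrite -P1 monic_neq0 ?Cyclotomic_monic.
have := prod_Cyclotomic l_gt0.
rewrite (perm_big [:: 1%N; l]) /=; last first.
  apply: uniq_perm => [||m].
  - exact: divisors_uniq.
  - by rewrite /= inE neq_ltn prime_gt1.
  - rewrite -dvdn_divisors // !inE; apply/idP/idP => [/(primeP pr_l).2 //|].
    by case/orP => /eqP ->; rewrite ?dvd1n ?dvdnn.
rewrite big_cons big_seq1 P1 subrX1 => /(mulfI nz) ->.
by [].
Qed.

Lemma horner_Cyclotomic_prime (R : nzRingType) (l : nat) (x : R) :
  prime l -> (map_poly intr 'Phi_l).[x] = Phi l x.
Proof.
move=> pr_l; rewrite Cyclotomic_prime // rmorph_sum /= horner_sum.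
by apply: eq_bigr => i _; rewrite map_polyXn hornerXn.
Qed.

Definition pth_power_free (p : nat) (d : int) : Prop :=
  forall l : nat, prime l -> ~~ ((l ^ p)%N%:Z %| d)%Z.

Section RingOfIntegers.
Variable K : fieldExtType rat.

Definition integers : {pred K} := fun x => `[< integralOver (intr : int -> K) x >].

Fact integers_subring : subring_closed integers.
Proof.
split=> [|x y /asboolP Ix /asboolP Iy|x y /asboolP Ix /asboolP Iy]; apply/asboolP.
- exact: integral1.
- exact: integral_sub.
- exact: integral_mul.
Qed.
HB.instance Definition _ := GRing.isSubringClosed.Build K integers
  integers_subring.

Record ringOfIntegers := RingOfIntegers {
  integer_val :> K;
  _ : integer_val \in integers }.

HB.instance Definition _ := [isSub for integer_val].
HB.instance Definition _ := [Choice of ringOfIntegers by <:].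
HB.instance Definition _ := [SubChoice_isSubComNzRing of ringOfIntegers by <:].
End RingOfIntegers.

(* The quotient R / aR.  MathComp's {ideal_quot I} needs I to be proper;      *)
(* here the quotient may be trivial, so only a comPzRingType results.         *)
Section QuotientByElement.
Variables (R : comNzRingType) (a : R).

Definition multiples : {pred R} := fun x => `[< exists y : R, x = a * y >].

Fact multiples_zmod : zmod_closed multiples.
Proof.
split=> [|x y /asboolP[u ->] /asboolP[v ->]]; apply/asboolP.
  by exists 0; rewrite mulr0.
by exists (u - v); rewrite mulrBr.
Qed.
HB.instance Definition _ := GRing.isZmodClosed.Build R multiples multiples_zmod.

Fact multiplesMl (x y : R) : y \in multiples -> x * y \in multiples.
Proof. by move=> /asboolP[u ->]; apply/asboolP; exists (x * u); rewrite mulrCA. Qed.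

Definition quotBy : Type := Quotient.quot multiples.
HB.instance Definition _ := GRing.Zmodule.on quotBy.
HB.instance Definition _ := EqQuotient.on quotBy.

Fact quotBy_eqP (x y : R) : \pi_quotBy x = \pi_quotBy y <-> x - y \in multiples.
Proof. by rewrite Quotient.idealrBE; split => /eqP. Qed.

Definition quotBy_one : quotBy := \pi_quotBy 1.
Definition quotBy_mul (x y : quotBy) : quotBy := \pi_quotBy (repr x * repr y).

Fact quotBy_mulE (x y : R) : quotBy_mul (\pi_quotBy x) (\pi_quotBy y) = \pi_quotBy (x * y).
Proof.
apply/quotBy_eqP; set x' := repr _; set y' := repr _.
have hx : x' - x \in multiples by apply/quotBy_eqP; rewrite reprK.
have hy : y' - y \in multiples by apply/quotBy_eqP; rewrite reprK.
have -> : x' * y' - x * y = x' * (y' - y) + y * (x' - x).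
  by rewrite !mulrBr (mulrC y x') (mulrC y x) addrA subrK.
by rewrite rpredD ?multiplesMl.
Qed.

Fact quotBy_addE (x y : R) : \pi_quotBy x + \pi_quotBy y = \pi_quotBy (x + y).
Proof. exact/esym/Quotient.pi_add. Qed.

Fact quotBy_ind (P : quotBy -> Prop) :
  (forall x : R, P (\pi_quotBy x)) -> forall u, P u.
Proof. by move=> Ppi u; rewrite -[u]reprK. Qed.

Fact quotBy_mulA : associative quotBy_mul.
Proof.
by elim/quotBy_ind=> x; elim/quotBy_ind=> y; elim/quotBy_ind=> z; rewrite !quotBy_mulE mulrA.
Qed.
Fact quotBy_mulC : commutative quotBy_mul.
Proof. by elim/quotBy_ind=> x; elim/quotBy_ind=> y; rewrite !quotBy_mulE mulrC. Qed.
Fact quotBy_mul1 : left_id quotBy_one quotBy_mul.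
Proof. by elim/quotBy_ind=> x; rewrite quotBy_mulE mul1r. Qed.
Fact quotBy_mulDl : left_distributive quotBy_mul +%R.
Proof.
elim/quotBy_ind=> x; elim/quotBy_ind=> y; elim/quotBy_ind=> z.
by rewrite !(quotBy_mulE, quotBy_addE) mulrDl.
Qed.

HB.instance Definition _ := GRing.Zmodule_isComPzRing.Build quotBy
  quotBy_mulA quotBy_mulC quotBy_mul1 quotBy_mulDl.

Definition quotBy_pi (x : R) : quotBy := \pi_quotBy x.
Fact quotBy_pi_zmod : zmod_morphism quotBy_pi.
Proof.
by move=> x y; apply: (canRL (addrK _)); rewrite quotBy_addE subrK.
Qed.
HB.instance Definition _ := GRing.isZmodMorphism.Build R quotBy quotBy_pi
  quotBy_pi_zmod.
Fact quotBy_pi_monoid : monoid_morphism quotBy_pi.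
Proof. by split=> // x y; rewrite /quotBy_pi -quotBy_mulE. Qed.
HB.instance Definition _ := GRing.isMonoidMorphism.Build R quotBy quotBy_pi
  quotBy_pi_monoid.
End QuotientByElement.

(* O_K / N O_K *)
Definition RN (K : fieldExtType rat) (N : nat) : comPzRingType :=
  quotBy (N%:R : ringOfIntegers K).

(* GRing.unit is only available in nontrivial rings, hence the explicit       *)
(* inverse.                                                                   *)
Definition gen_unitary (p : nat) (K : fieldExtType rat) (N : nat) (w : RN K N)
  : Prop := (exists v : RN K N, w * v = 1) /\ w ^+ Phi p N = 1.

(* Main.v *)
Require Import Defs.
From HB Require Import structures.
From mathcomp Require Import all_boot all_order all_algebra all_field.
From mathcomp Require Import boolp.
From mathcomp Require Import ring zify.

Set Implicit Arguments.
Unset Strict Implicit.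
Unset Printing Implicit Defensive.

Import Order.TTheory GRing.Theory Num.Theory.
Local Open Scope ring_scope.

(** Write O for the ring of integers of K = Q(theta); since theta ^ p = d, the
    degree of K is at most p. A congruence in O is studied by linear algebra
    modulo a rational prime r: any family of more than [K : Q] elements of O
    satisfies a primitive integer relation ([integral_relation]), which stays
    nontrivial after reduction modulo r. So O / rO behaves like an F_r-algebra
    of dimension at most p, and no integral basis is ever chosen. Together
    with Bezout relations over F_r lifted to the integers
    ([multiples_bezout]), this settles both implications.

    If N is prime, the hypothesis on d ^ ((N - 1) / p) says that d is not a p-th
    power in F_N, and then X ^ p - d is irreducible over F_N: it is coprime to
    every nonzero polynomial of smaller degree ([coprimep_XnsubC_small]).
    Hence O / NO is a field ([inverse_mod_inert_prime]). There, with
    v = w ^ k, one has Phi_q(v) (v - 1) = v ^ q - 1 = w ^ (Phi_p(N)) - 1 = 0 and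
    v <> 1, so that Phi_q(v) = 0.

    If N is composite, let r be its smallest prime factor, so r ^ 2 <= N.
    A zero of Phi_q in O / rO is annihilated by a nonzero polynomial of degree
    at most p over F_r as well, hence Phi_q has an irreducible factor of some
    degree j <= p over F_r, whose roots are primitive q-th roots of unity in the
    field with r ^ j elements; therefore q divides r ^ j - 1
    ([root_Phi_mod_prime]). But k < sqrt N forces q ^ 2 > N ^ (2p - 3)
    ([sqr_gt_of_Phi]), and this is too large ([ndvdn_card_residue]). *)

(** * The sums Phi *)

Lemma Phi_subr1 (R : comPzRingType) (q : nat) (x : R) :
  Phi q x * (x - 1) = x ^+ q - 1.
Proof. by rewrite subrX1 mulrC. Qed.

Lemma Phi_rmorph (R S : pzSemiRingType) (f : {rmorphism R -> S}) (l : nat) (x : R) :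
  f (Phi l x) = Phi l (f x).
Proof. by rewrite rmorph_sum; apply: eq_bigr => i _; rewrite rmorphXn. Qed.

(** * The quotient by one element *)

Lemma multiplesP (R : comNzRingType) (a x : R) :
  reflect (exists y, x = a * y) (x \in multiples a).
Proof. exact: asboolP. Qed.

Lemma quotBy_pi_eq0 (R : comNzRingType) (a x : R) :
  quotBy_pi a x = 0 <-> x \in multiples a.
Proof. by rewrite -(rmorph0 (quotBy_pi a)) -[X in X \in _]subr0; exact: quotBy_eqP. Qed.

Lemma quotBy_pi_inverse (R : comNzRingType) (a x y : R) :
  x * y - 1 \in multiples a -> quotBy_pi a x * quotBy_pi a y = 1.
Proof.
move/quotBy_pi_eq0/eqP; rewrite rmorphB rmorphM rmorph1.
by rewrite subr_eq0 => /eqP.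
Qed.

(** * Reduction of integer polynomials modulo a prime *)

Definition redp (r : nat) : {poly int} -> {poly 'F_r} := map_poly intr.
HB.instance Definition _ r := GRing.RMorphism.on (redp r).
Definition lift_poly (r : nat) (f : {poly 'F_r}) : {poly int} :=
  map_poly (fun x : 'F_r => (val x)%:Z) f.

Lemma lift_polyK (r : nat) (f : {poly 'F_r}) : redp r (lift_poly f) = f.
Proof.
apply/polyP=> i; rewrite coef_map coef_map_id0 //=.
exact: natr_Zp.
Qed.

Lemma redp_eq0P (r : nat) (g : {poly int}) : prime r ->
  reflect (exists h, g = h * r%:R) (redp r g == 0).
Proof.
move=> pr_r; apply: (iffP eqP) => [g0|[h ->]]; last first.
  by rewrite rmorphM rmorph_nat /= -polyC_natr pchar_Fp_0 // mulr0.
exists (map_poly (fun x => (x %/ r)%Z) g); apply/polyP=> i.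
rewrite -polyC_natr coefMC coef_map_id0 ?div0z // natz divzK //.
by rewrite (dvdz_pcharf (pchar_Fp pr_r)) -coef_map -/(redp r g) g0 coef0.
Qed.

Lemma redp_primitive_neq0 (r : nat) (g : {poly int}) :
  prime r -> zcontents g = 1 -> redp r g != 0.
Proof.
move=> pr_r g1; apply/negP=> /redp_eq0P[//|h gh].
have : (r %| zcontents g)%Z.
  rewrite dvdz_contents; apply/polyOverP=> i.
  by rewrite gh -polyC_natr coefMC natz dvdz_mull.
by rewrite g1 dvdz1 /= => /eqP r1; rewrite r1 in pr_r.
Qed.

(** The polynomials over F_r whose lifts F satisfy a F(u) = 0 modulo r form an
    ideal; it is all of F_r[X] once it contains two coprime elements. Working
    with lifts gives the conclusion without evaluating polynomials in R / rR,
    which may be the zero ring. *)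
Lemma multiples_bezout (R : comNzRingType) (r : nat) (a u : R)
    (G H : {poly int}) : prime r ->
  coprimep (redp r G) (redp r H) ->
  a * (map_poly intr G).[u] \in multiples r%:R ->
  a * (map_poly intr H).[u] \in multiples r%:R ->
  a \in multiples r%:R.
Proof.
move=> pr_r /Bezout_eq1_coprimepP[[U V] /= UV1].
have : redp r (lift_poly U * G + lift_poly V * H - 1) == 0.
  by rewrite rmorphB rmorphD !rmorphM rmorph1 /= !lift_polyK UV1 subrr.
case/redp_eq0P=> // W /(congr1 (fun P => (map_poly intr P : {poly R}).[u])).
rewrite rmorphB rmorphD !rmorphM rmorph1 rmorph_nat /= -polyC_natr !hornerE.
move: (map_poly _ _).[u] (map_poly _ _).[u] (map_poly _ _).[u]
  (map_poly _ _).[u] (map_poly _ _).[u] => w h m g l e ag ah.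
have -> : a = l * (a * g) + m * (a * h) - r%:R * (a * w).
  have {1}-> : a = a * (l * g + m * h - (l * g + m * h - 1)) by ring.
  by rewrite e; ring.
apply: rpredB; last by apply/multiplesP; exists (a * w).
by apply: rpredD; apply: multiplesMl.
Qed.

(** * Rings of integers modulo a prime *)

(** A rational relation can be scaled to a primitive integer one, since O is
    torsion-free. Primitivity is what keeps the relation nontrivial modulo every
    prime. The coefficients are packed in a polynomial because contents are
    defined for polynomials. *)
Lemma integral_relation (K : fieldExtType rat) (m : nat)
    (x : 'I_m -> ringOfIntegers K) : (\dim {:K} < m)%N ->
  exists2 g : {poly int}, (size g <= m)%N /\ zcontents g = 1
                        & \sum_(i < m) (g`_i)%:~R * x i = 0.
Proof.
move=> ltKm.
have /freeP nfree: ~~ free [tuple integer_val (x i) | i < m].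
  apply/negP=> /eqP fr; have := dimvS (subvf <<[tuple integer_val (x i) | i < m]>>).
  by rewrite fr size_tuple leqNgt ltKm.
have [k [k0 [i ki]]] : exists k : 'I_m -> rat,
    \sum_(i < m) k i *: integer_val (x i) = 0 /\ exists i, k i != 0.
  apply: contrapT => nk; apply: nfree => k sk i; apply/eqP/negPn/negP => ki.
  apply: nk; exists k; split; last by exists i.
  rewrite -{2}sk; apply: eq_bigr => j _.
  by rewrite -tnth_nth tnth_mktuple.
pose P : {poly rat} := rVpoly (\row_i k i).
have Pk (j : 'I_m) : P`_j = k j by rewrite coef_rVpoly_ord mxE.
have [q [a a0 Pq]] := rat_poly_scale P.
have q0 : q != 0.
  by apply: contraNneq ki => q0; rewrite -Pk Pq q0 rmorph0 scaler0 coef0.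
exists (zprimitive q).
  split; last by rewrite zcontents_primitive q0.
  rewrite size_zprimitive -(size_map_inj_poly (f := intr : int -> rat)) //; last first.
    exact: intr_inj.
  have /(congr1 (fun p : {poly _} => size p)) := Pq.
  by rewrite size_scale ?invr_eq0 ?intr_eq0 // => <-; apply: size_poly.
apply: val_inj; rewrite rmorph_sum rmorph0 /=.
have c0 : (zcontents q)%:~R / a%:~R != 0 :> rat.
  by rewrite mulf_neq0 ?invr_eq0 ?intr_eq0 // zcontents_eq0.
apply: (scalerI c0); rewrite scaler0 -{2}k0 scaler_sumr.
apply: eq_bigr => j _; rewrite -Pk Pq coefZ coef_map /=.
have -> : q`_j = zcontents q * (zprimitive q)`_j by rewrite {1}[q]zpolyEprim coefZ.
have -> n : integer_val (n%:~R : ringOfIntegers K) = n%:~R.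
  exact: (rmorph_int (val : ringOfIntegers K -> K)).
have -> (n : int) (v : K) : n%:~R * v = (n%:~R : rat) *: v.
  by rewrite mulrzl scaler_int.
rewrite scalerA [in RHS]intrM.
by rewrite mulrCA mulrA.
Qed.

(** An inverse of r in O would be a root of a monic integer polynomial;
    multiplying by a power of r makes 1 divisible by r. *)
Lemma one_notin_multiples (K : fieldExtType rat) (r : nat) : prime r ->
  (1 : ringOfIntegers K) \notin multiples r%:R.
Proof.
move=> pr_r; apply/multiplesP=> -[y] /(congr1 (val : ringOfIntegers K -> K)).
rewrite rmorphM rmorph1 rmorph_nat /=.
have [P monP /rootP] : integralOver (intr : int -> K) (val y) by apply/asboolP/(valP y).
set z : K := val y; move=> Pz0 rz.
pose n := (size P).-1.
have sP : (size P = n.+1)%N.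
  by rewrite prednK // lt0n size_poly_eq0 monic_neq0.
have Pn : P`_n = 1 by have /monicP := monP.
(* This integer is r ^ n P(1 / r), with the leading term set apart. *)
have : (P`_n + r%:Z * \sum_(i < n) P`_i * r%:Z ^+ (n - i).-1)%:~R = 0 :> K.
  have <- : (map_poly intr P).[z] * r%:R ^+ n = 0 by rewrite Pz0 mul0r.
  rewrite (horner_coef_wide (n := n.+1)); last first.
    by rewrite -sP size_poly.
  rewrite big_ord_recr /= mulrDl coef_map -mulrA -exprMn [z * _]mulrC -rz.
  rewrite expr1n mulr1 rmorphD addrC; congr (_ + _).
  rewrite rmorphM rmorph_sum big_distrr big_distrl; apply: eq_bigr => i _ /=.
  rewrite coef_map rmorphM rmorphXn /= mulrCA -mulrA; congr (_ * _).
  rewrite -exprS prednK ?subn_gt0 //.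
  have -> : z ^+ i * r%:R ^+ n = (r%:R * z) ^+ i * r%:R ^+ (n - i).
    by rewrite exprMn mulrAC -exprD subnKC 1?mulrC // ltnW.
  by rewrite -rz expr1n mul1r.
move/eqP; rewrite -(rmorph_int (in_alg K)) fmorph_eq0 intr_eq0 Pn => /eqP e.
have : (r%:Z %| 1)%Z.
  apply/dvdzP; exists (- \sum_(i < n) P`_i * r%:Z ^+ (n - i).-1).
  by apply/eqP; rewrite mulNr mulrC -addr_eq0; apply/eqP; exact: e.
by rewrite dvdz1 /= => /eqP r1; rewrite r1 in pr_r.
Qed.

Lemma dim_radical_ext (F : fieldType) (K : fieldExtType F) (n : nat) (c : F)
    (theta : K) : (0 < n)%N -> theta ^+ n = c%:A -> <<1; theta>>%VS = {:K}%VS ->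
  (\dim {:K} <= n)%N.
Proof.
move=> n0 thc <-; rewrite dim_Fadjoin dimv1 muln1 -ltnS -size_minPoly.
rewrite -(size_XnsubC (c%:A : K) n0) dvdp_leq ?monic_neq0 ?monicXnsubC //.
rewrite minPoly_dvdp ?rpredB ?rpredX ?polyOverX ?polyOverC ?rpredZ ?mem1v //.
by rewrite /root !hornerE thc subrr.
Qed.

Lemma radical_integer (K : fieldExtType rat) (n : nat) (d : int) (theta : K) :
  (0 < n)%N -> theta ^+ n = d%:~R ->
  exists t : ringOfIntegers K, t ^+ n = d%:~R.
Proof.
move=> n0 thd.
have It : theta \in @integers K.
  apply/asboolP; exists ('X^n - d%:P); first exact: monicXnsubC.
  by rewrite /root rmorphB /= map_polyXn map_polyC !hornerE thd subrr.
exists (RingOfIntegers It); apply: val_inj.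
by rewrite rmorphXn rmorph_int.
Qed.

(** * Polynomials over finite fields *)

Lemma companion_exists (R : comNzRingType) (m : nat) (h : {poly R}) :
  h \is monic -> size h = m.+2 -> exists A : 'M[R]_m.+1, char_poly A = h.
Proof.
move=> monh sz; have := companionmxK monh.
by move: (companionmx h); rewrite sz => A; exists A.
Qed.

(** A common divisor h of degree n, with 0 < n < p, has a companion matrix A,
    and A ^ p = a because h divides X ^ p - a. Taking determinants,
    (det A) ^ p = a ^ n, hence (a ^ e) ^ n = 1 by Fermat. As also (a ^ e) ^ p = 1
    and n is prime to p, this gives a ^ e = 1. *)
Lemma coprimep_XnsubC_small (F : finFieldType) (p e : nat) (a : F)
    (g : {poly F}) : prime p -> #|F|.-1 = (p * e)%N -> a != 0 -> a ^+ e != 1 ->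
  g != 0 -> (size g <= p)%N -> coprimep g ('X^p - a%:P).
Proof.
move=> pr_p cF a0 ae g0 sg; apply/coprimepP=> h hg ha.
have h0 : h != 0 by apply: contraNneq g0 => h0; rewrite h0 dvd0p in hg.
rewrite -size_poly_eq1 eqn_leq lt0n size_poly_eq0 h0 andbT leqNgt.
apply/negP=> h1.
pose m := (size h).-2.
(* The size of a polynomial is its degree plus one, so h has degree m + 1. *)
have sh : size h = m.+2 by rewrite /m; case: (size h) h1 => [|[]].
have lh : lead_coef h != 0 by rewrite lead_coef_eq0.
have [A cA] : exists A : 'M[F]_m.+1, char_poly A = (lead_coef h)^-1 *: h.
  apply: companion_exists; last by rewrite size_scale ?invr_eq0.
  by rewrite monicE lead_coefZ mulVf.
have Ap : A ^+ p = a%:M.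
  have /dvdpP[v vE] : (lead_coef h)^-1 *: h %| 'X^p - a%:P.
    by rewrite dvdpZl ?invr_eq0.
  have := congr1 (horner_mx A) vE; rewrite rmorphM -cA /= Cayley_Hamilton mulr0.
  rewrite rmorphB rmorphXn /= horner_mx_X horner_mx_C => /eqP.
  by rewrite subr_eq0 => /eqP.
have dA : (\det A) ^+ p = a ^+ m.+1.
  have <- : \det (A ^+ p) = \det A ^+ p.
    elim: (p) => [|n IH]; first by rewrite !expr0 det1.
    by rewrite !exprS det_mulmx IH.
  by rewrite Ap det_scalar.
have dA0 : \det A != 0.
  apply: contraNneq (expf_neq0 m.+1 a0) => dA0.
  by rewrite -dA dA0 expr0n gtn_eqF ?prime_gt0.
have fermat x : x != 0 -> x ^+ #|F|.-1 = 1 :> F.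
  move=> x0; apply: (mulfI x0).
  by rewrite -exprS mulr1 prednK ?expf_card // (cardD1 0).
have am : (a ^+ e) ^+ m.+1 = 1.
  by rewrite -exprM mulnC exprM -dA -exprM -cF fermat.
have ap : (a ^+ e) ^+ p = 1 by rewrite -exprM mulnC -cF fermat.
have [k prk /(dvdn_trans _) kp] := prim_order_exists (prime_gt0 pr_p) ap.
have kp' : (k %| p)%N by apply: kp.
have km : (k %| m.+1)%N by rewrite (prim_order_dvd prk) am.
have : k = 1.
  apply/eqP; rewrite -dvdn1.
  have /eqP <- : coprime p m.+1; last by rewrite dvdn_gcd kp'.
  rewrite prime_coprime // gtnNdvd //.
  by rewrite -ltnS -sh ltnS; apply: leq_trans (dvdp_leq g0 hg) sg.
move=> k1; move: (prim_order_dvd prk 1); rewrite k1 dvdnn expr1 => /esym.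
by rewrite (negPf ae).
Qed.

(** A root z of the common factor, in a splitting field of it, has order q, and
    its degree j over F is at most that of g. So z lies in the subfield with
    #|F| ^ j elements, whose nonzero elements form a group of order
    #|F| ^ j - 1. *)
Lemma dvdn_card_of_Phi_factor (F : finFieldType) (q n : nat) (g : {poly F}) :
  prime q -> q%:R != 0 :> F -> g != 0 -> (size g <= n.+1)%N ->
  ~~ coprimep g (Phi q 'X) -> exists2 j, (0 < j <= n)%N & (q %| (#|F| ^ j).-1)%N.
Proof.
move=> pr_q q0 g0 sg ncop.
pose h := gcdp g (Phi q 'X).
have h0 : h != 0 by rewrite gcdp_eq0 negb_and g0.
have [L [rs hrs _]] := FinSplittingFieldFor h0.
have [z rz] : exists z, z \in rs.
  case: rs hrs => [|z rs _]; last by exists z; rewrite mem_head.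
  rewrite big_nil => /eqp_size; rewrite size_map_poly size_poly1 => /eqP.
  by move: ncop; rewrite /coprimep -/h => /negPf->.
have hz : root (map_poly (in_alg L) h) z.
  by rewrite (eqp_root hrs) root_prod_XsubC.
have gz : root (map_poly (in_alg L) g) z.
  by apply: root_dvdp hz; rewrite dvdp_map dvdp_gcdl.
have z0 : Phi q z = 0.
  have /rootP : root (map_poly (in_alg L) (Phi q 'X)) z.
    by apply: root_dvdp hz; rewrite dvdp_map dvdp_gcdr.
  rewrite rmorph_sum horner_sum /= => <-.
  by apply: eq_bigr => i _; rewrite map_polyXn hornerXn.
have zq : z ^+ q = 1 by apply/eqP; rewrite -subr_eq0 -Phi_subr1 z0 mul0r.
have z1 : z != 1.
  apply: contra_eq_neq z0 => ->; rewrite /Phi.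
  under eq_bigr do rewrite expr1n.
  by rewrite sumr_const card_ord -(rmorph_nat (in_alg L)) fmorph_eq0.
have zn0 : z != 0.
  by apply: contra_eq_neq zq => ->; rewrite expr0n gtn_eqF ?prime_gt0 // eq_sym oner_eq0.
exists (adjoin_degree 1%AS z).
  rewrite lt0n; apply/andP; split; first by rewrite -lt0n.
  rewrite -ltnS -size_minPoly; apply: leq_trans sg.
  rewrite -(size_map_poly (in_alg L)) dvdp_leq ?map_poly_eq0 //.
  by rewrite minPoly_dvdp // alg_polyOver.
have := memv_adjoin 1%AS z; rewrite Fermat's_little_theorem /=.
rewrite dim_Fadjoin dimv1 muln1; set j := adjoin_degree _ _ => zj.
have zj1 : z ^+ (#|F| ^ j).-1 = 1.
  apply: (mulfI zn0); rewrite -exprS mulr1 prednK ?(eqP zj) //.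
  by rewrite expn_gt0 (cardD1 0).
have [k prk kq] := prim_order_exists (prime_gt0 pr_q) zq.
have [_ /(_ k kq) /orP[/eqP k1|/eqP <-]] := primeP pr_q; last first.
  by rewrite (prim_order_dvd prk) zj1.
by move: (prim_order_dvd prk 1); rewrite k1 dvdnn expr1 (negPf z1).
Qed.

(** * Zeros of Phi and inverses in the ring of integers modulo a prime *)

(** The powers 1, u, ..., u ^ n are dependent modulo r, so u is a zero of a
    nonzero polynomial g of degree at most n over F_r. Were g coprime to Phi_q,
    a Bezout relation would give 1 = 0 modulo r. *)
Lemma root_Phi_mod_prime (K : fieldExtType rat) (n r q : nat)
    (u : ringOfIntegers K) : (\dim {:K} <= n)%N -> prime r -> prime q ->
  r != q -> Phi q u \in multiples r%:R ->
  exists2 j, (0 < j <= n)%N & (q %| (r ^ j).-1)%N.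
Proof.
move=> dK pr_r pr_q rq uq.
have [g [sg g1] gu] := @integral_relation K n.+1 (fun i => u ^+ i) dK.
have := @dvdn_card_of_Phi_factor 'F_r q n (redp r g) pr_q.
rewrite card_Fp //; apply.
- rewrite -(dvdn_pcharf (pchar_Fp pr_r)) dvdn_prime2 //.
- exact: redp_primitive_neq0.
- by apply: leq_trans sg; apply: size_poly.
apply: contra (one_notin_multiples K pr_r) => cop.
have PhiE : redp r (Phi q 'X) = Phi q 'X.
  by rewrite rmorph_sum; apply: eq_bigr => i _; rewrite /= /redp map_polyXn.
rewrite -PhiE in cop.
apply: (multiples_bezout (u := u) pr_r cop); rewrite mul1r.
  rewrite (horner_coef_wide (n := n.+1)) ?(leq_trans (size_poly _ _)) //.
  under eq_bigr do rewrite coef_map.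
  by rewrite gu rpred0.
rewrite rmorph_sum horner_sum /=.
by under eq_bigr do rewrite map_polyXn hornerXn.
Qed.

(** The p + 1 elements 1, a, a t, ..., a t ^ (p - 1) are dependent modulo N. The
    coefficient of 1 is nonzero modulo N: otherwise a is killed by G(t) with G
    of degree less than p, hence coprime to X ^ p - d, and a = 0. Dividing by
    that coefficient exhibits an inverse of a. *)
Lemma inverse_mod_inert_prime (K : fieldExtType rat) (p e N : nat) (d : int)
    (t a : ringOfIntegers K) : (\dim {:K} <= p)%N -> prime p -> prime N ->
  N.-1 = (p * e)%N -> t ^+ p = d%:~R -> ~~ (N %| d)%Z ->
  ~~ (N %| d ^+ e - 1)%Z -> a \notin multiples N%:R ->
  exists b, a * b - 1 \in multiples N%:R.
Proof.
move=> dK pr_p pr_N Ne tp d0 de aN.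
(* The index i > 0 stands for a t ^ (i - 1), hence the shift in G. *)
pose x (i : 'I_p.+1) := if i == ord0 then 1 else a * t ^+ i.-1.
have [g [sg g1] gu] := @integral_relation K p.+1 x dK.
pose G : {poly int} := \poly_(i < p) g`_i.+1.
have Gg : (g`_0)%:~R + a * (map_poly intr G).[t] = 0.
  rewrite -[RHS]gu big_ord_recl /= /x eqxx mulr1; congr (_ + _).
  rewrite (horner_coef_wide (n := p)); last first.
    by rewrite (leq_trans (size_poly _ _)) ?size_poly.
  rewrite big_distrr; apply: eq_bigr => i _ /=.
  by rewrite coef_map coef_poly ltn_ord /= mulrCA.
have [/dvdzP[c g0]|g0] := boolP (N %| g`_0)%Z.
  case/negP: aN.
  have G0 : redp N G != 0.
    apply: contraNneq (redp_primitive_neq0 pr_N g1) => G0.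
    apply/eqP/polyP=> -[|i]; rewrite coef0 coef_map /=.
      by rewrite g0 rmorphM /= -pmulrn pchar_Fp_0 // mulr0.
    have [ip|pi] := ltnP i p; last by rewrite nth_default ?(leq_trans sg).
    have /(congr1 (fun P : {poly 'F_N} => P`_i)) := G0.
    by rewrite coef0 coef_map coef_poly ip.
  have cop : coprimep (redp N G) (redp N ('X^p - d%:P)).
    rewrite rmorphB /= /redp map_polyXn map_polyC /=.
    apply: (coprimep_XnsubC_small (e := e)) => //.
    - by rewrite card_Fp.
    - by rewrite -(dvdz_pcharf (pchar_Fp pr_N)).
    - rewrite -rmorphXn -subr_eq0 -[X in _ - X](rmorph1 intr) -rmorphB.
      by rewrite -(dvdz_pcharf (pchar_Fp pr_N)).
    - by rewrite (leq_trans (size_poly _ _)) ?size_poly.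
  apply: (multiples_bezout pr_N cop (u := t)).
    have /eqP := Gg; rewrite addrC addr_eq0 g0 => /eqP ->.
    apply/multiplesP; exists (- c%:~R).
    by rewrite intrM mulrN mulrC.
  rewrite rmorphB /= map_polyXn map_polyC !hornerE tp subrr mulr0.
  exact: rpred0.
have /coprimezP[[c m] /= cm] : coprimez N g`_0.
  by rewrite coprimezE prime_coprime.
exists (- m%:~R * (map_poly intr G).[t]); apply/multiplesP.
exists (- c%:~R).
have cmO : c%:~R * N%:R + m%:~R * (g`_0)%:~R = 1 :> ringOfIntegers K.
  by rewrite -[RHS]/(1%:~R) -cm intrD !intrM.
rewrite -[X in _ - X]cmO.
have -> : (g`_0)%:~R = - (a * (map_poly intr G).[t]).
  by apply/eqP; rewrite -addr_eq0 Gg.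
ring.
Qed.

(** * The size of q *)

Lemma exp_nat (x n : nat) : x ^+ n = (x ^ n)%N.
Proof. by elim: n => // n IH; rewrite exprS expnS IH. Qed.

Lemma Phi_nat_ge (p N : nat) : (0 < p)%N -> (N ^ p.-1 <= Phi p N)%N.
Proof.
by case: p => // p _; rewrite /Phi big_ord_recr /= exp_nat; apply: leq_addl.
Qed.

(** From k q >= N ^ (p - 1), square and cancel k ^ 2 < N. *)
Lemma sqr_gt_of_Phi (p q k N : nat) : (1 < p)%N -> (k ^ 2 < N)%N ->
  Phi p N = (k * q)%N -> (N ^ (2 * p - 3) < q ^ 2)%N.
Proof.
move=> p1 kN PhiN; have N0 : (0 < N)%N by apply: leq_trans kN.
have kq : (N ^ p.-1 <= k * q)%N by rewrite -PhiN Phi_nat_ge // ltnW.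
have q0 : (0 < q)%N.
  by rewrite lt0n; apply: contraTneq kq => ->; rewrite muln0 -ltnNge expn_gt0 N0.
(* The factor N turns the exponent 2p - 3 into 2 (p - 1). *)
rewrite -(ltn_pmul2l N0) -expnS.
have -> : (2 * p - 3).+1 = (p.-1 * 2)%N by lia.
rewrite expnM; apply: (@leq_ltn_trans ((k * q) ^ 2)%N); first by rewrite leq_sqr.
by rewrite expnMn ltn_pmul2r // expn_gt0 q0.
Qed.

(** For p >= 3 one has p <= 2p - 3, so q exceeds r ^ p. For p = 2 only q > r is
    available: the prime q, dividing (r - 1) (r + 1), must then be r + 1, and two
    consecutive primes are 2 and 3; but r = 2 divides p. *)
Lemma ndvdn_card_residue (p q N r j : nat) : prime p -> prime q -> prime r ->
  (r ^ 2 <= N)%N -> ~~ (r %| p)%N -> (N ^ (2 * p - 3) < q ^ 2)%N ->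
  (0 < j <= p)%N -> ~~ (q %| (r ^ j).-1)%N.
Proof.
move=> pr_p pr_q pr_r rN rp Nq /andP[j0 jp].
have [[r1 p1] q1] := (prime_gt1 pr_r, prime_gt1 pr_p, prime_gt1 pr_q).
have N1 : (0 < N)%N by apply: leq_trans rN; rewrite expn_gt0 ltnW.
have qr n : (n <= 2 * p - 3)%N -> (r ^ n < q)%N.
  move=> np; rewrite -ltn_sqr -expnM mulnC expnM.
  apply: leq_ltn_trans Nq; apply: leq_trans (leq_pexp2l N1 np).
  by case: n np => // n _; rewrite leq_exp2r.
have rj : (1 < r ^ j)%N by rewrite -{1}(exp1n j) ltn_exp2r.
apply/negP => qd; have qj : (q <= (r ^ j).-1)%N by apply: dvdn_leq qd; lia.
have [p3|p3] := leqP 3 p.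
  have : (r ^ j < q)%N by apply: qr; lia.
  lia.
have p2 : p = 2%N by lia.
have rq : (r < q)%N by rewrite -[r]expn1 qr // p2.
have r2 : (r != 2)%N by apply: contraNneq rp => ->; rewrite p2.
have [j1|j1] := leqP j 1.
  have jE : j = 1%N by lia.
  by move: qj; rewrite jE expn1; lia.
have jE : j = 2%N by lia.
have : (q %| (r - 1) * (r + 1))%N.
  by rewrite -subn_sqr exp1n subn1 -[in X in (_ ^ X)%N]jE.
rewrite Euclid_dvdM // => /orP[/dvdn_leq|/dvdn_leq]; first by lia.
move=> qr1; have qE : q = r.+1 by lia.
have [q2|oq] := even_prime pr_q; first by lia.
have [r2'|or] := even_prime pr_r; first by rewrite r2' in r2.
by rewrite qE /= or in oq.
Qed.

(** * The primality criterion *)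

Theorem theorem9p8 (p q : nat) (d : int) (N k : nat)
    (K : fieldExtType rat) (theta : K) (w : RN K N) :
  prime p -> prime q -> (p < q)%N ->
  pth_power_free p d ->
  (0 < N)%N -> N = 1 %[mod p] ->
  (0 < k)%N -> Phi p N = (k * q)%N -> k%:R < sqrtC (N%:R : algC) ->
  gcdz N (p%:Z * d) = 1 ->
  (d ^+ ((N - 1) %/ p) <> 1 %[mod N])%Z ->
  theta ^+ p = d%:~R -> <<1; theta>>%VS = {:K}%VS ->
  gen_unitary p w ->
  w ^+ k <> 1 ->
  prime N <-> Phi q (w ^+ k) = 0.
Proof.
move=> pr_p pr_q _ _ N0 Np _ PhiN kN cop dN thd Kth [_ wPhi] wk.
have p0 := prime_gt0 pr_p.
have dK : (\dim {:K} <= p)%N.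
  by apply: (dim_radical_ext (c := d%:~R) p0 _ Kth); rewrite thd -(rmorph_int (in_alg K)).
have /andP[Ncp Ncd] : coprimez N p%:Z && coprimez N d.
  by rewrite -coprimezMr /coprimez cop.
split=> [pr_N | Phi0].
  have [t tp] := radical_integer p0 thd.
  have Ne : N.-1 = (p * ((N - 1) %/ p))%N.
    by rewrite mulnC divnK ?subn1 // -subn1 -eqn_mod_dvd //; apply/eqP.
  have [a wa] : exists a, quotBy_pi N%:R a = w ^+ k - 1 :> RN K N.
    by elim/quotBy_ind: (w ^+ k - 1) => a; exists a.
  have nd : ~~ (N %| d)%Z by rewrite -prime_coprime.
  have nde : ~~ (N %| d ^+ ((N - 1) %/ p) - 1)%Z.
    by rewrite -eqz_mod_dvd; apply/eqP.
  have na : a \notin multiples N%:R.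
    apply/negP=> /quotBy_pi_eq0 a0; apply: wk; apply/eqP.
    by rewrite -subr_eq0; apply/eqP; apply: etrans (esym wa) a0.
  have [b] := inverse_mod_inert_prime dK pr_p pr_N Ne tp nd nde na.
  move/quotBy_pi_inverse => ab.
  have {}ab : (w ^+ k - 1) * quotBy_pi N%:R b = 1 by rewrite -wa; exact: ab.
  by rewrite -[LHS]mulr1 -ab mulrA Phi_subr1 -exprM -PhiN wPhi subrr mul0r.
have [u uw] : exists u, quotBy_pi N%:R u = w ^+ k :> RN K N.
  by elim/quotBy_ind: (w ^+ k) => u; exists u.
(* If N = 1 the quotient ring is trivial, which contradicts w ^ k <> 1. *)
have N1 : (1 < N)%N.
  rewrite ltn_neqAle N0 andbT; apply: contra_notN wk => /eqP N1.
  elim/quotBy_ind: (w ^+ k) => x.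
  apply/quotBy_eqP/multiplesP; exists (x - 1).
  by rewrite -N1 mul1r.
have kN2 : (k ^ 2 < N)%N.
  rewrite -(ltr_nat algC) natrX -[X in _ < X]sqrtCK.
  by rewrite ltr_pXn2r ?nnegrE ?ler0n ?sqrtC_ge0.
have qN := sqr_gt_of_Phi (prime_gt1 pr_p) kN2 PhiN.
apply: contraT => nprN.
set r := pdiv N; have pr_r : prime r := pdiv_prime N1.
have rN : (r ^ 2 <= N)%N by rewrite leqNgt; apply: contra nprN; apply: ltn_pdiv2_prime.
have rp : ~~ (r %| p)%N.
  rewrite -prime_coprime //; apply: coprime_dvdl (pdiv_dvd N) _.
  by rewrite -(coprimezE N p).
have rq : r != q.
  rewrite neq_ltn -ltn_sqr (leq_ltn_trans rN) //; apply: leq_ltn_trans qN.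
  have e1 : (0 < 2 * p - 3)%N by rewrite subn_gt0 (leq_mul2l 2 2 p) prime_gt1.
  by rewrite -[X in (X <= _)%N]expn1; apply: leq_pexp2l.
have uq : Phi q u \in multiples r%:R.
  have : Phi q u \in multiples N%:R.
    by move: Phi0; rewrite -uw -Phi_rmorph => /quotBy_pi_eq0.
  case/multiplesP=> y ->; apply/multiplesP; exists ((N %/ r)%:R * y).
  by rewrite mulrA -natrM mulnC divnK ?pdiv_dvd.
have [j jp qj] := root_Phi_mod_prime dK pr_r pr_q rq uq.
by have := ndvdn_card_residue pr_p pr_q pr_r rN rp qN jp; rewrite qj.
Qed.
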